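(* Let $n\ge 1$, $L\ge 0$, $T_c>0$, $r>0$. Suppose that $G:\mathbb{R}\to\mathbb{R}^n$ is such that $\dot x=G(x_1)+A_0x+D\delta(t)$, $|\delta(t)|\le L$, is globally asymptotically stable; that $\Phi$ satisfies Assumption 2; and that $\{\rho,F\}$ satisfy Assumption 3. Assume that there exists a known constant $T_{\max}^*<+\infty$ such that the settling time function $\mathcal T$ of the auxiliary system satisfies $\sup_{z_0\in\mathbb{R}^n}\mathcal T(z_0)\le T_{\max}^*$ (so that $T_f=T_{\max}^*$ is used in Assumption 3 and in the definition of $\eta$). Then the time-varying gain $\kappa(t-t_0)$ appearing in $$H(y_1,t,T_c)=\begin{cases}\Lambda(r\kappa(t-t_0))F(y_1), & t\in[t_0,t_0+\eta T_c),\\ G(y_1), & \text{otherwise},\end{cases}\qquad \Lambda(k)=\mathrm{diag}(k,k^2,\ldots,k^n),$$ of the redesigned system $\dot y=H(y_1,t,T_c)+A_0y+D\delta(t)$ is bounded, for $t\in[t_0,t_0+\eta T_c)$, as $$\kappa(t-t_0)\le\lim_{t\to t_0+\eta T_c}\rho\circ\psi^{-1}(t-t_0)=\lim_{\tau\to T_{\max}^*}\rho(\tau)<+\infty.$$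
   Context: Notation: $\mathbb{R}_+=[0,\infty)$, $\bar{\mathbb{R}}_+=\mathbb{R}_+\cup\{+\infty\}$. $A_0=[a_{ij}]\in\mathbb{R}^{n\times n}$ has $a_{i,i+1}=1$ and all other entries $0$; $D=[0,\ldots,0,1]^T\in\mathbb{R}^n$; $M=\mathrm{diag}(0,1,\ldots,n-1)$; $x_1,y_1,z_1$ denote first components. Solutions are understood in the sense of Filippov; the systems considered are assumed to have existence and uniqueness of forward solutions (except at the origin) and the origin as unique equilibrium. ''Stable'' means ''the origin is globally stable'', uniformly over all admissible disturbances; admissible disturbances are those with $|\delta|\le L$ (respectively $|\hat\delta|\le L$). Settling time: for a system with solutions $x(t;x_0,t_0,\delta)$, $T(x_0,t_0)=\inf\{\xi\ge t_0:\ \text{for all admissible }\delta,\ \lim_{t\to\xi}x(t;x_0,t_0,\delta)=0\}-t_0\in\bar{\mathbb{R}}_+$. Assumption 2: $\Phi:\mathbb{R}_+\to\bar{\mathbb{R}}_+\setminus\{0\}$ satisfies $\int_0^{+\infty}\Phi(z)\,dz=1$; $\Phi(\tau)<+\infty$ for all $\tau>0$; and $\Phi$ is either non-increasing or locally Lipschitz on $\mathbb{R}_+\setminus\{0\}$. Put $\rho(\tau)=\frac1{T_c}\Phi(\tau)^{-1}$ (reciprocal). Auxiliary system (initial time $\tau_0=0$, initial condition $z_0$): $$\frac{dz}{d\tau}=rF(z_1)+rA_0z-\rho(\tau)^{-1}\frac{d\rho(\tau)}{d\tau}Mz+(r\rho(\tau))^{-n}D\hat\delta(\tau),\qquad |\hat\delta(\tau)|\le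 L,$$ with $F:\mathbb{R}\to\mathbb{R}^n$. Assumption 3: (i) the origin of the auxiliary system is asymptotically stable with settling time function $\mathcal T(z_0)$ satisfying $\mathcal T(z_0)\le T_f$ for a known constant $T_f\in\bar{\mathbb{R}}_+$; (ii) for any disturbance $\hat\delta$, the solution satisfies $\lim_{\tau\to\infty}\rho(\tau)^{i-1}z_i(\tau;z_0,0,\hat\delta)=0$ for $i=1,\ldots,n$. Further definitions: $\psi(\tau)=T_c\int_0^\tau\Phi(\xi)\,d\xi$; $\eta=\lim_{\tau\to T_f}T_c^{-1}\psi(\tau)$; $\kappa(t-t_0)=\rho(\psi^{-1}(t-t_0))$ for $t\in[t_0,t_0+\eta T_c)$ and $\kappa(t-t_0)=1$ otherwise.
   Formalization: The bound κ(t−t₀) ≤ lim ρ is stated only for Φ non-increasing on [0,T*_max), since it fails for some locally Lipschitz Φ (e.g. with an interior minimum); existence, equality and finiteness of the limits (taken from the left) hold under all of Assumption 2. *)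

(* Defs.v *)
(* MathComp-Analysis. The state space R^n, n >= 1, is 'cV[R]_m.+1 (n = m.+1), so
   that component i of the usual 1-based indexing is the row i.-1 of the vector. *)
From HB Require Import structures.
From mathcomp Require Export all_boot all_order all_algebra.
From mathcomp Require Export all_classical all_reals all_analysis.
Export Order.TTheory GRing.Theory Num.Theory numFieldNormedType.Exports.
Set Implicit Arguments.
Unset Strict Implicit.
Unset Printing Implicit Defensive.

Local Open Scope classical_set_scope.
Local Open Scope ring_scope.

Section Filippov.
Context {R : realType} {m : nat}.
Local Notation state := 'cV[R]_m.+1.
Implicit Types (A N : set state).

Definition null_set N : Prop :=
  forall e : R, 0 < e -> exists a b : nat -> state,
    [/\ forall k i, a k i 0 <= b k i 0,
        N `<=` \bigcup_k [set x | forall i, a k i 0 <= x i 0 <= b k i 0]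
      & (\sum_(0 <= k <oo) (\prod_(i < m.+1) (b k i 0 - a k i 0))%:E <= e%:E)%E].

Definition closed_convex_hull A : set state :=
  \bigcap_(C in [set C : set state | [/\ closed C, convex_set C & A `<=` C]]) C.

(* The ball is the one of the sup norm; any norm gives the same set. *)
Definition filippov (f : state -> state) (x : state) : set state :=
  \bigcap_(e in [set e : R | 0 < e]) \bigcap_(N in null_set)
    closed_convex_hull (f @` (ball x e `\` N)).

Definition abs_continuous (a b : R) (x : R -> state) : Prop :=
  forall e : R, 0 < e -> exists2 d : R, 0 < d &
    forall (K : nat) (u v : 'I_K -> R),
      (forall k, [/\ a <= u k, u k <= v k & v k <= b]) ->
      (forall j k, j != k -> v j <= u k \/ v k <= u j) ->
      \sum_(k < K) (v k - u k) < d ->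
      \sum_(k < K) `|x (v k) - x (u k)| < e.

(* [f d t x] is the velocity at time [t] and state [x] when the value of the
   disturbance at time [t] is [d]. *)
Definition system := R -> R -> state -> state.

Definition admissible (L t0 : R) (delta : R -> R) : Prop :=
  measurable_fun `[t0, +oo[ delta /\ forall t, t0 <= t -> `|delta t| <= L.

Definition solution (f : system) (t0 : R) (x0 : state) (delta : R -> R)
    (x : R -> state) : Prop :=
  [/\ x t0 = x0,
      forall b, t0 <= b -> abs_continuous t0 b x
    & {ae (@lebesgue_measure R), forall t : R, t0 < t ->
        derivable x t 1 /\ filippov (f (delta t) t) (x t) ('D_1 x t)}].

Definition equilibrium (L : R) (f : system) (t0 : R) (c : state) : Prop :=
  forall delta, admissible L t0 delta -> solution f t0 c delta (fun=> c).

(* Forward existence and uniqueness, except at the origin: solutions start away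
   from the origin, and uniqueness is only asked until the origin is reached. *)
Definition well_posed (L : R) (f : system) (t0 : R) : Prop :=
  [/\ forall x0 delta, x0 != 0 -> admissible L t0 delta ->
        exists x, solution f t0 x0 delta x,
      forall x0 delta x x', x0 != 0 -> admissible L t0 delta ->
        solution f t0 x0 delta x -> solution f t0 x0 delta x' ->
        forall t, t0 <= t -> (forall s, t0 <= s < t -> x s != 0) -> x t = x' t
    & forall c, equilibrium L f t0 c <-> c = 0].

Definition globally_asymptotically_stable (L : R) (f : system) (t0 : R) : Prop :=
  (forall e : R, 0 < e -> exists2 d : R, 0 < d &
     forall x0 delta x, `|x0| < d -> admissible L t0 delta ->
       solution f t0 x0 delta x -> forall t, t0 <= t -> `|x t| < e) /\
  (forall x0 (e : R), 0 < e -> exists T : R,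
     forall delta x, admissible L t0 delta -> solution f t0 x0 delta x ->
       forall t, t0 + T <= t -> t0 <= t -> `|x t| < e).

(* Only real xi need be considered: when there is none the infimum is +oo. The
   limit is taken along the times t >= t0, t != xi. *)
Definition settling_time (L : R) (f : system) (t0 : R) (x0 : state) : \bar R :=
  let S := [set xi : R | t0 <= xi /\
    forall delta x, admissible L t0 delta -> solution f t0 x0 delta x ->
      x t @[t --> within `[t0, +oo[ xi^'] --> (0 : state)] in
  (ereal_inf (EFin @` S) - t0%:E)%E.

End Filippov.
Arguments system : clear implicits.

Section Systems.
Context {R : realType} {m : nat}.
Local Notation state := 'cV[R]_m.+1.

Definition A0 : 'M[R]_m.+1 := \matrix_(i, j) (j == i.+1 :> nat)%:R.
Definition Dvec : state := \col_i (i == ord_max)%:R.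
Definition Mmx : 'M[R]_m.+1 := diag_mx (\row_i (i : nat)%:R).
Definition Lambda (k : R) : 'M[R]_m.+1 := diag_mx (\row_i k ^+ i.+1).

Definition base_system (G : R -> state) : system R m :=
  fun d _ x => G (x 0 0) + A0 *m x + d *: Dvec.

Definition aux_system (r : R) (F : R -> state) (rho : R -> R) : system R m :=
  fun d tau z => r *: F (z 0 0) + r *: (A0 *m z)
    - ((rho tau)^-1 * derive1 rho tau) *: (Mmx *m z)
    + (r * rho tau) ^- m.+1 *: (d *: Dvec).

Definition Hfun (F G : R -> state) (r Tc eta t0 : R) (kappa : R -> R)
    (y1 t : R) : state :=
  if t0 <= t < t0 + eta * Tc then Lambda (r * kappa (t - t0)) *m F y1 else G y1.

Definition redesigned_system (F G : R -> state) (r Tc eta t0 : R)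
    (kappa : R -> R) : system R m :=
  fun d t y => Hfun F G r Tc eta t0 kappa (y 0 0) t + A0 *m y + d *: Dvec.

Definition aux_assumption (L r : R) (F : R -> state) (rho : R -> R)
    (Tf : \bar R) : Prop :=
  [/\ (0 <= Tf)%E,
      globally_asymptotically_stable L (aux_system r F rho) 0,
      forall z0, (settling_time L (aux_system r F rho) 0 z0 <= Tf)%E
    & forall z0 delta z, admissible L 0 delta ->
        solution (aux_system r F rho) 0 z0 delta z ->
        forall i : 'I_m.+1, rho tau ^+ i * z tau i 0 @[tau --> +oo] --> (0 : R)].

End Systems.

Section Gain.
Context {R : realType}.
Implicit Types Phi : R -> \bar R.

(* Functions on R_+ are total functions on R, of which only the restriction to
   R_+ matters. *)
Definition nonincreasing_on (A : set R) Phi : Prop :=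
  forall s t : R, A s -> A t -> s <= t -> (Phi t <= Phi s)%E.

Definition weight_assumption Phi : Prop :=
  [/\ forall tau, 0 <= tau -> (0 < Phi tau)%E,
      (\int[@lebesgue_measure R]_(z in `[0%R, +oo[) Phi z = 1)%E,
      forall tau, 0 < tau -> (Phi tau < +oo)%E
    & nonincreasing_on `[0, +oo[ Phi \/
      [locally [lipschitz (fine (Phi tau) : R^o) | tau in (`]0, +oo[ : set R^o)]]].

(* Extended inverse: rho tau = 0 where Phi tau = +oo. *)
Definition rho_of (Tc : R) Phi (tau : R) : R := Tc^-1 * fine (Phi tau)^-1%E.

Definition psi_of (Tc : R) Phi (tau : R) : R :=
  Tc * fine (\int[@lebesgue_measure R]_(z in `[0%R, tau]) Phi z)%E.

Definition psi_inv (Tc : R) Phi : R -> R :=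
  'pinv_(fun=> 0) `[0, +oo[ (psi_of Tc Phi).

(* Filter of the real tau tending to Tf from below. *)
Definition left_of (Tf : \bar R) : set_system R :=
  match Tf with
  | T%:E => T^'-
  | +oo%E => +oo%R
  | -oo%E => -oo%R
  end.

Definition eta_of (Tc : R) Phi (Tf : \bar R) : R :=
  lim (Tc^-1 * psi_of Tc Phi tau @[tau --> left_of Tf]).

Definition kappa_of (Tc : R) Phi (Tf : \bar R) (s : R) : R :=
  if 0 <= s < eta_of Tc Phi Tf * Tc then rho_of Tc Phi (psi_inv Tc Phi s) else 1.

End Gain.

(* Main.v *)
(* A solution that starts away from 0 stays away from 0 for some time, because it
   is continuous; hence settling times of nonzero states are positive and
   Tmax > 0. At Tmax > 0 the weight Phi has a finite positive left limit: by
   monotonicity (it is then at least Phi Tmax > 0) or by continuity, so rho has a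
   finite left limit l there. Since Phi is positive and integrable, psi is
   continuous and strictly increasing, so psi_inv tends to Tmax from below at
   eta * Tc = psi Tmax, and rho \o psi_inv tends to l as well. When Phi is
   non-increasing on [0, Tmax[, rho is non-decreasing there, hence at most l. *)
Require Import Defs.
From mathcomp Require Import measurable_realfun.
Local Open Scope classical_set_scope.
Local Open Scope ring_scope.

Section SettlingTime.
Set Implicit Arguments.
Unset Strict Implicit.
Context {R : realType} {m : nat}.
Local Notation state := 'cV[R]_m.+1.

Lemma abs_continuous_dist (a b : R) (x : R -> state) : abs_continuous a b x ->
  forall e : R, 0 < e -> exists2 d : R, 0 < d &
    forall s t, a <= s -> s <= t -> t <= b -> t - s < d -> `|x t - x s| < e.
Proof.
move=> xac e e0; have [d d0 xd] := xac e e0; exists d => // s t sa st tb tsd.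
have := xd 1%N (fun=> s) (fun=> t); rewrite !big_ord1; apply => //.
by move=> j k; rewrite !ord1 eqxx.
Qed.

Lemma settling_time_gt0 (L t0 : R) (f : system R m) (x0 : state)
    (delta : R -> R) (x : R -> state) :
  x0 != 0 -> admissible L t0 delta -> solution f t0 x0 delta x ->
  (0 < settling_time L f t0 x0)%E.
Proof.
move=> x0_neq0 adm sol; have [xt0 xac _] := sol.
have e0 : 0 < `|x0| / 2 by rewrite divr_gt0// normr_gt0.
have t01 : t0 <= t0 + 1 by rewrite lerDl.
have [d d0 xd] := abs_continuous_dist (xac _ t01) e0.
pose c := Num.min d 1.
have c0 : 0 < c by rewrite lt_min d0 ltr01.
rewrite /settling_time sube_gt0.
apply: (@lt_le_trans _ _ (t0 + c)%:E); first by rewrite lte_fin ltrDl.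
apply: le_ereal_inf_tmp => _ [xi [t0xi xicvg] <-]; rewrite lee_fin leNgt.
apply/negP => xic.
have /cvgrPdist_lt /(_ _ e0) := xicvg delta x adm sol.
rewrite near_withinE => /nbhs_ballP[eps /= eps0 xeps].
pose t := xi + Num.min eps (t0 + c - xi) / 2.
have mn0 : 0 < Num.min eps (t0 + c - xi) by rewrite lt_min eps0 subr_gt0.
have mn2 : Num.min eps (t0 + c - xi) / 2 < Num.min eps (t0 + c - xi).
  by rewrite ltr_pdivrMr// ltr_pMr// ltr1n.
have xit : xi < t by rewrite ltrDl divr_gt0.
have t0t : t0 <= t by rewrite (le_trans t0xi)// ltW.
have tc : t < t0 + c.
  by rewrite -ltrBrDl (lt_le_trans mn2)// ge_min lexx orbT.
have xte : `|x t| < `|x0| / 2.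
  rewrite -[x t]subr0 distrC; apply: xeps.
  - rewrite /ball/= distrC gtr0_norm ?subr_gt0// /t addrC addKr.
    by rewrite (lt_le_trans mn2)// ge_min lexx.
  - by rewrite gt_eqF.
  - by rewrite in_itv/= t0t.
have xtx0 : `|x t - x0| < `|x0| / 2.
  rewrite -{1}xt0; apply: xd => //.
    by rewrite (le_trans (ltW tc))// lerD2l ge_min lexx orbT.
  by rewrite ltrBlDl (lt_le_trans tc)// lerD2l ge_min lexx.
have : `|x0| < `|x0|.
  rewrite {2}(splitr `|x0|) (le_lt_trans _ (ltrD xte xtx0))//.
  by rewrite -{1}(subrK (x t) x0) addrC (le_trans (ler_normD _ _))// distrC.
by rewrite ltxx.
Qed.
End SettlingTime.

Section Gain.
Set Implicit Arguments.
Unset Strict Implicit.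
Context {R : realType}.
Local Notation mu := (@lebesgue_measure R).
Implicit Types (Phi : R -> \bar R) (f : R -> R).

Lemma measurable_fun_nonincreasing_in (D : set R) f : is_interval D ->
  (forall s t, D s -> D t -> s <= t -> f t <= f s) -> measurable_fun D f.
Proof.
move=> itvD f_ni.
apply: (measurability (@RGenCInfty.G R)) => [|/= _ [_] [r] -> <-].
  exact: RGenCInfty.measurableE.
apply: is_interval_measurable => s t [Ds fs] [Dt ft] u /andP[su ut].
have Du : D u by apply: (itvD s t) => //; rewrite su.
have /andP[rft _] : (r <= f t) && true := ft.
by split => //; apply/andP; split => //; exact: (le_trans rft (f_ni _ _ Du Dt ut)).
Qed.

Lemma locally_lipschitz_continuous (A : set R) f : open A ->
  [locally [lipschitz (f x : R^o) | x in (A : set R^o)]] ->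
  {in A, continuous f}.
Proof.
move=> oA flip x; rewrite inE => Ax.
have nA : nbhs x A by apply: open_nbhs_nbhs; split.
(* Here [locally] ranges over A `*` A: use it at the diagonal point (x, x). *)
have [M [_ Mf]] := flip (x, x) (conj Ax Ax).
pose K := `|M| + 1.
have K0 : 0 < K by rewrite ltr_wpDl.
have MK : M < K by rewrite (le_lt_trans (ler_norm _))// ltrDl.
have fK := Mf _ MK.
have [[U V] /= [nU nV] UV] := fK.
apply/cvgrPdist_lt => e e0; near=> y.
have Ay : A y by near: y; exact: nA.
have Vy : V y by near: y.
have := UV (x, y) (conj (nbhs_singleton nU) Vy) (conj Ax Ay).
rewrite /= => /le_lt_trans; apply; rewrite mulrC -ltr_pdivlMr//.
by near: y; apply: cvgr_dist_lt; [exact: cvg_id|exact: divr_gt0].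
Unshelve. all: by end_near. Qed.

Section Weight.
Context {Tc : R} {Phi : R -> \bar R}.
Hypotheses (Tc0 : 0 < Tc) (PhiW : weight_assumption Phi).
Let g := fine \o Phi.

Let Phi_fin (t : R) : 0 < t -> Phi t = (g t)%:E.
Proof.
move: PhiW => [Phi0 _ Phioo _] t0; rewrite fineK// fin_numE.
by rewrite gt_eqF ?lt_eqF// ?Phioo// (lt_trans _ (Phi0 t (ltW t0)))//.
Qed.

Let g_gt0 (t : R) : 0 < t -> 0 < g t.
Proof.
by move=> t0; have [Phi0 _ _ _] := PhiW; rewrite -lte_fin -Phi_fin// Phi0// ltW.
Qed.

Lemma weight_measurable : measurable_fun (`]0, +oo[ : set R) g.
Proof.
have [_ _ _ [Phini|Philip]] := PhiW.
  apply: measurable_fun_nonincreasing_in; first exact: interval_is_interval.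
  move=> s t; rewrite /= !in_itv/= !andbT => s0 t0 st.
  by rewrite -lee_fin -!Phi_fin// Phini//= in_itv/= ?ltW.
by apply: open_continuous_measurable_fun => //;
  apply: locally_lipschitz_continuous.
Qed.

Let mg : measurable_fun (`[0, +oo[ : set R) (EFin \o g).
Proof.
apply/measurable_EFinP/measurable_fun_itv_obnd_cbndP; exact: weight_measurable.
Qed.

Let eq_integral_weight (b : itv_bound R) : (b <= +oo)%O ->
  (\int[mu]_(t in [set` Interval (BLeft (0%R : R)) b]) Phi t =
   \int[mu]_(t in [set` Interval (BLeft (0%R : R)) b]) (g t)%:E)%E.
Proof.
move=> boo; have sub : [set` Interval (BRight (0%R : R)) b]  `<=` `]0, +oo[.
  exact: subset_itvl.
have mgb : measurable_fun [set` Interval (BRight (0%R : R)) b] (EFin \o g).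
  by apply/measurable_EFinP; apply: measurable_funS sub weight_measurable.
have gPhi : {in [set` Interval (BRight (0%R : R)) b], EFin \o g =1 Phi}.
  move=> t; rewrite inE => /sub; rewrite /= in_itv/= andbT => t0.
  by rewrite Phi_fin.
rewrite -[LHS]integral_itv_obnd_cbnd; last exact: eq_measurable_fun mgb.
rewrite -[RHS]integral_itv_obnd_cbnd//.
by apply: eq_integral => t tb; rewrite -gPhi.
Qed.

Lemma weight_integrable : mu.-integrable (`[0, +oo[ : set R) (EFin \o g).
Proof.
apply/integrableP; split => //.
have [Phi0 Phi1 _ _] := PhiW.
rewrite (_ : (\int[mu]_(x in _) _)%E = 1%E) ?ltry// -Phi1.
rewrite eq_integral_weight//; apply: eq_integral => t.
rewrite inE/= in_itv/= andbT => t0.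
by rewrite ger0_norm// fine_ge0// ltW// Phi0.
Qed.

Let ig (a b : R) : 0 <= a -> mu.-integrable `[a, b] (EFin \o g).
Proof.
move=> a0; apply: integrableS weight_integrable => //.
by move=> t; rewrite /= !in_itv/= andbT => /andP[/(le_trans a0)].
Qed.

Lemma psi_ofE (t : R) : psi_of Tc Phi t = Tc * \int[mu]_(z in `[0, t]) g z.
Proof. by rewrite /psi_of eq_integral_weight. Qed.

Lemma psi_of0 : psi_of Tc Phi 0 = 0.
Proof. by rewrite psi_ofE set_itv1 Rintegral_set1 mulr0. Qed.

Lemma psi_of_lt (s t : R) : 0 <= s -> s < t ->
  psi_of Tc Phi s < psi_of Tc Phi t.
Proof.
move=> s0 st; rewrite !psi_ofE ltr_pM2l// -subr_gt0.
rewrite Rintegral_itvB ?bnd_simp//; [|exact: ig|exact: ltW].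
have g0 z : z \in `]s, t] -> 0 < g z.
  by rewrite in_itv/= => /andP[sz _]; apply/g_gt0/(le_lt_trans s0).
rewrite lt_neqAle Rintegral_ge0 ?andbT; last by move=> z /g0/ltW.
have igst : mu.-integrable `]s, t] (EFin \o g).
  apply: (integrableS _ _ _ (ig t s0)) => //.
  by apply: subset_itvr; rewrite bnd_simp.
apply/eqP => /esym I0.
have : (\int[mu]_(z in `]s, t]) `|(g z)%:E| = 0)%E.
  rewrite -[RHS]/(0%:E) -I0 /Rintegral fineK; last exact: integrable_fin_num.
  apply: eq_integral => z; rewrite inE => /g0 gz0.
  by rewrite gee0_abs// lee_fin ltW.
move/(ae_eq_integral_abs mu (measurable_itv _) (measurable_int _ igst)).
move=> [N [mN N0 gN]].
have : (mu `]s, t] <= mu N)%E.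
  apply: le_measure; rewrite ?inE//; move=> z stz; apply: gN => /= /(_ stz).
  by case=> gz0; have := g0 _ stz; rewrite gz0 ltxx.
rewrite [X in (_ <= X)%E](_ : _ = 0%E)//.
by rewrite lebesgue_measure_itv/= lte_fin st -EFinB lee_fin leNgt subr_gt0 st.
Qed.

Let psi_of_le (s t : R) : 0 <= s -> s <= t ->
  psi_of Tc Phi s <= psi_of Tc Phi t.
Proof. by move=> s0; rewrite le_eqVlt => /predU1P[->//|/(psi_of_lt s0)/ltW]. Qed.

Lemma psi_of_cvg_at_left (T : R) : 0 < T ->
  psi_of Tc Phi t @[t --> T^'-] --> psi_of Tc Phi T.
Proof.
move=> T0; rewrite psi_ofE (_ : psi_of Tc Phi = fun t =>
  Tc * \int[mu]_(z in `[0, t]) g z); last by apply/funext => t; rewrite psi_ofE.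
by apply: cvgMr; exact: parameterized_integral_cvg_at_left (ig _ _).
Qed.

Lemma psi_of_surj (T : R) : 0 <= T ->
  set_surj `[0, T] `[0, psi_of Tc Phi T] (psi_of Tc Phi).
Proof.
move=> T0.
have := segment_continuous_le_surjective T0 (psi_of_le (lexx 0) T0).
rewrite psi_of0; apply.
rewrite (_ : psi_of Tc Phi = fun t =>
  Tc * \int[mu]_(z in `[0, t]) g z); last first.
  by apply/funext => t; rewrite psi_ofE.
move=> t; apply: cvgMr.
exact: (parameterized_integral_continuous T0 (ig T (lexx 0)) (x := t)).
Qed.

Lemma psi_ofK (t : R) : 0 <= t -> psi_inv Tc Phi (psi_of Tc Phi t) = t.
Proof.
move=> t0; apply: pinvKV; last by rewrite inE/= in_itv/= t0.
move=> u v; rewrite !inE/= !in_itv/= !andbT => u0 v0 uv.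
have [/(psi_of_lt u0)|/(psi_of_lt v0)|//] := ltgtP u v; by rewrite uv ltxx.
Qed.

Lemma psi_inv_itv (a b s : R) : 0 <= a -> a <= b ->
  psi_of Tc Phi a <= s < psi_of Tc Phi b -> a <= psi_inv Tc Phi s < b.
Proof.
move=> a0 ab /andP[as_ sb]; have b0 := le_trans a0 ab.
have s0 : 0 <= s by rewrite (le_trans _ as_)// -psi_of0 psi_of_le.
have [|t] := psi_of_surj b0 (_ : `[0, psi_of Tc Phi b]%classic s).
  by rewrite /= in_itv/= s0 ltW.
rewrite /= in_itv/= => /andP[t0 tb] ts; rewrite -ts psi_ofK//.
apply/andP; split; [rewrite leNgt|rewrite ltNge]; apply/negP.
  by move=> /(psi_of_lt t0); rewrite ts ltNge as_.
by move=> /(psi_of_le b0); rewrite ts leNgt sb.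
Qed.

Lemma psi_inv_cvg_at_left (T : R) : 0 < T ->
  psi_inv Tc Phi s @[s --> (psi_of Tc Phi T)^'-] --> T^'-.
Proof.
move=> T0 A [e /= e0 TA].
pose a := Num.max 0 (T - e / 2).
have a0 : 0 <= a by rewrite le_max lexx.
have aT : a < T by rewrite gt_max T0 ltrBlDr ltrDl divr_gt0.
have Ta : T - a < e.
  by rewrite ltrBlDl -ltrBlDr lt_max ltrD2l ltrN2 ltr_pdivrMr// ltr_pMr// ltr1n orbT.
suff : \forall s \near (psi_of Tc Phi T)^'-, A (psi_inv Tc Phi s) by [].
near=> s.
have /andP[ats tT] : a <= psi_inv Tc Phi s < T.
  apply: psi_inv_itv => //; first exact: ltW.
  apply/andP; split; near: s; last exact: nbhs_left_lt.
  by apply: nbhs_left_ge; exact: psi_of_lt.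
apply: TA => //=; rewrite gtr0_norm ?subr_gt0//.
by rewrite (le_lt_trans _ Ta)// lerB.
Unshelve. all: by end_near. Qed.

Lemma eta_ofE (T : R) : 0 < T -> eta_of Tc Phi T%:E * Tc = psi_of Tc Phi T.
Proof.
move=> T0; rewrite /eta_of/= (@cvg_lim _ _ _ _ _ _ (Tc^-1 * psi_of Tc Phi T))//.
  by rewrite mulrC mulVKf// gt_eqF.
by apply: cvgMr; exact: psi_of_cvg_at_left.
Qed.

Lemma weight_cvg_at_left (T : R) : 0 < T ->
  exists2 l : R, 0 < l & g t @[t --> T^'-] --> l.
Proof.
move=> T0; have [_ _ _ [Phini|Philip]] := PhiW; last first.
  exists (g T); first exact: g_gt0.
  apply: cvg_at_left_filter.
  apply: (@locally_lipschitz_continuous `]0, +oo[%classic) => //.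
  by rewrite inE/= in_itv/= T0.
have gni s t : 0 < s -> s <= t -> g t <= g s.
  move=> s0 st; have t0 := lt_le_trans s0 st.
  by rewrite -lee_fin -!Phi_fin// Phini//= in_itv/= ?andbT ltW.
have cvgg : cvg (g t @[t --> T^'-]).
  rewrite -is_cvgNE; apply: nondecreasing_at_left_is_cvgr.
    apply: filterS (nbhs_left_gt T0) => x x0 u v.
    rewrite !in_itv/= => /andP[xu _] _ uv.
    by rewrite lerN2 gni// (lt_trans _ xu)//.
  apply: filterS (nbhs_left_gt T0) => x x0.
  exists (- g T) => _ [u + <-]; rewrite /= in_itv/= => /andP[xu uT].
  by rewrite lerN2 gni ?(ltW uT)// (lt_trans _ xu)//.
exists (lim (g t @[t --> T^'-])) => //.
rewrite (lt_le_trans (g_gt0 T0))//; apply: limr_ge => //.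
near=> t; apply: gni; near: t; first exact: nbhs_left_gt.
exact: nbhs_left_le.
Unshelve. all: by end_near. Qed.

Lemma rho_of_cvg_at_left (T : R) : 0 < T ->
  exists l : R, rho_of Tc Phi t @[t --> T^'-] --> l.
Proof.
move=> T0; have [l l0 gl] := weight_cvg_at_left T0; exists (Tc^-1 * l^-1).
apply: cvgMr; apply: (@cvg_trans _ ((fun t : R => (g t)^-1) @ T^'-)); last first.
  by apply: cvgV => //; rewrite gt_eqF.
apply: near_eq_cvg; near=> t.
have t0 : 0 < t by near: t; exact: nbhs_left_gt.
by rewrite Phi_fin// inver gt_eqF ?g_gt0.
Unshelve. all: by end_near. Qed.

Lemma rho_of_le (s t : R) : 0 <= s -> 0 < t -> (Phi t <= Phi s)%E ->
  rho_of Tc Phi s <= rho_of Tc Phi t.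
Proof.
move=> s0 t0; rewrite /rho_of ler_pM2l ?invr_gt0// (Phi_fin t0) inver.
rewrite gt_eqF ?g_gt0//=; have [/(_ s s0) + _ _ _] := PhiW.
case: (Phi s) => [x|_ _|//]; last by rewrite invey/= invr_ge0 ltW ?g_gt0.
rewrite lte_fin lee_fin => x0 gx; rewrite inver gt_eqF//=.
by rewrite lef_pV2 ?posrE ?g_gt0.
Qed.
End Weight.
End Gain.

(* n = m.+1; both limits are taken from the left; the finite common value of the
   two limits is the real l. The bound kappa <= l is stated when Phi is
   non-increasing on [0, Tmax[, in particular under the first alternative of
   weight_assumption. For a merely locally Lipschitz Phi it is false in general
   (take Phi with an interior minimum on ]0, Tmax[; see NOTES.md). *)
Theorem corollary2 (R : realType) (m : nat) (L Tc r t0 : R)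
    (G F : R -> 'cV[R]_m.+1) (Phi : R -> \bar R) (Tmax : R)
    (rho := rho_of Tc Phi) (psi_1 := psi_inv Tc Phi)
    (eta := eta_of Tc Phi Tmax%:E) (kappa := kappa_of Tc Phi Tmax%:E) :
  0 <= L -> 0 < Tc -> 0 < r ->
  well_posed L (base_system G) t0 ->
  well_posed L (aux_system r F rho) 0 ->
  well_posed L (redesigned_system F G r Tc eta t0 kappa) t0 ->
  globally_asymptotically_stable L (base_system G) t0 ->
  weight_assumption Phi ->
  aux_assumption L r F rho Tmax%:E ->
  (ereal_sup (range (settling_time L (aux_system r F rho) 0)) <= Tmax%:E)%E ->
  exists l : R,
    [/\ rho (psi_1 (t - t0)) @[t --> (t0 + eta * Tc)^'-] --> l,
        rho tau @[tau --> Tmax^'-] --> l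
      & nonincreasing_on `[0, Tmax[ Phi ->
        forall t, t0 <= t < t0 + eta * Tc -> kappa (t - t0) <= l].
Proof.
move=> L0 Tc0 r0 _ aux_wp _ _ PhiW aux_as _.
have [Tmax0 _ settle _] := aux_as.
have {Tmax0}T0 : 0 < Tmax.
  rewrite lt_neqAle -lee_fin Tmax0 andbT; apply/eqP => TE.
  pose z0 : 'cV[R]_m.+1 := const_mx 1.
  have z0_neq0 : z0 != 0.
    by apply/eqP => /matrixP /(_ 0 0) /eqP; rewrite !mxE oner_eq0.
  have adm : admissible L 0 (cst 0 : R -> R).
    by split; [exact: measurable_cst|move=> t _; rewrite normr0].
  have [ex_sol _ _] := aux_wp; have [z sol] := ex_sol _ _ z0_neq0 adm.
  have := settling_time_gt0 z0_neq0 adm sol.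
  by rewrite ltNge; move: (settle z0); rewrite -TE => ->.
have etaE : eta * Tc = psi_of Tc Phi Tmax by exact: eta_ofE.
have [l rhol] := rho_of_cvg_at_left (Tc := Tc) PhiW T0.
exists l; split => //.
- rewrite etaE; have psi_inv_cvg := psi_inv_cvg_at_left Tc0 PhiW T0.
  pose shift t := t - t0.
  have shift_cvg :
      shift @ (t0 + psi_of Tc Phi Tmax)^'- --> (psi_of Tc Phi Tmax)^'-.
    move=> A [e /= e0 eA]; exists e => //= t te tlt; apply: eA.
      by rewrite /= opprB addrCA addrA.
    by rewrite ltrBlDl.
  exact: (cvg_comp _ _ (cvg_comp _ _ shift_cvg psi_inv_cvg) rhol).
- move=> Phi_ni t /andP[t0t tlt].
  have s0 : 0 <= t - t0 by rewrite subr_ge0.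
  have sT : t - t0 < eta * Tc by rewrite ltrBlDl.
  rewrite /kappa /kappa_of -/eta s0 sT /=.
  have /andP[u0 uT] : 0 <= psi_inv Tc Phi (t - t0) < Tmax.
    apply: psi_inv_itv => //; first exact: ltW.
    by rewrite psi_of0// s0 -etaE.
  apply: (cvgr_to_ge rhol); near=> tau.
  have utau : psi_inv Tc Phi (t - t0) < tau by near: tau; exact: nbhs_left_gt.
  have tau0 := le_lt_trans u0 utau.
  apply: rho_of_le => //; apply: Phi_ni; rewrite /= ?in_itv/= ?u0 ?(ltW tau0)//.
  - by near: tau; exact: nbhs_left_lt.
  - exact: ltW.
Unshelve. all: by end_near. Qed.
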